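(* Let $\ell \geq 2$ be an integer. For every $u\in C_c(\mathbb{N})$ with $u_k=0$ for all $0 \leq k \leq \ell-1$, there holds $$\sum_{n\in\mathbb{N},\; 2n \geq \ell } |(\Delta^{\ell/2}u)_n|^2 \;\geq\; \Big[\frac{(2\ell)!}{4^\ell\,\ell!}\Big]^2\sum_{n= \ell}^\infty \frac{u_n^2}{n^{2\ell}}.$$
   Context: $\mathbb{N}=\{0,1,2,\dots\}$ and $C_c(\mathbb{N})$ is the space of finitely supported real sequences $u=(u_n)_{n\in\mathbb{N}}$. The discrete gradient is $(\nabla u)_n = u_n-u_{n-1}$ and the discrete Laplacian is $(\Delta u)_n = 2u_n-u_{n+1}-u_{n-1}$ (each defined at those $n$ for which all indices involved are available). For even $\ell=2m$, $\Delta^{\ell/2}=\Delta^m$ is the $m$-fold iterate; for odd $\ell=2m+1$, $\Delta^{\ell/2}$ means $\nabla\Delta^{m}$. With these conventions $(\Delta^{\ell/2}u)_n$ is well defined from the values $u_j$, $j\ge 0$, whenever $2n\geq \ell$. *)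

(* Defs.v *)
From mathcomp Require Import all_boot all_order all_algebra.
From mathcomp Require Import all_classical all_reals all_analysis.

Set Implicit Arguments.
Unset Strict Implicit.
Unset Printing Implicit Defensive.

Import Order.TTheory GRing.Theory Num.Theory.
Local Open Scope ring_scope.
Local Open Scope classical_set_scope.

Definition finitely_supported (R : realType) (u : nat -> R) : Prop :=
  finite_set [set n | u n != 0].

(* The operators below are total: at n = 0, where u_(n-1) is not available,
   n.-1 = 0 makes their value meaningless. The junk value at 0 can reach
   (Delta^m u)_n only if n < m, and (nabla Delta^m u)_n only if n <= m, so
   [half_laplacian l u n] does not depend on it as soon as l <= 2 * n. *)
Definition gradient (R : realType) (u : nat -> R) : nat -> R :=
  fun n => u n - u n.-1.

Definition laplacian (R : realType) (u : nat -> R) : nat -> R :=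
  fun n => 2 * u n - u n.+1 - u n.-1.

(* Delta^(l/2), for even and odd l. *)
Definition half_laplacian (R : realType) (l : nat) (u : nat -> R) : nat -> R :=
  let v := iter l./2 (@laplacian R) u in
  if odd l then gradient v else v.

(* Main.v *)
Require Import Defs.
From mathcomp Require Import all_boot all_order all_algebra.
From mathcomp Require Import all_classical all_reals all_analysis.
From mathcomp Require Import zify ring lra.

Import Order.TTheory GRing.Theory Num.Theory.
Local Open Scope ring_scope.

(** Up to sign and a shift, Delta^(l/2) is the l-th power of the gradient, and
    for v n = u (n + l - 1), which vanishes at 0, one iterates a weighted Hardy
    inequality as in the continuous Birman inequalities. The exact power
    weights are replaced by w_a(n) = 1 / (n (n+1) ... (n+2a-1)), for which the
    ground state Gamma(n+a+1/2) / Gamma(n) gives the inequality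
    sum w_a (grad v)^2 >= (a+1/2)^2 sum w_a(n) v_n^2 / ((n+a-1/2) (n+2a)).
    The last weight dominates 1 / (n+l-1)^(2l) when a = l - 1, because the
    factors n, ..., n+2l-2 are centred at n+l-1. *)

Definition rising_weight (R : realType) (a n : nat) : R :=
  (\prod_(j < 2 * a) (n + j)%:R)^-1.

Lemma rising_weight_gt0 (R : realType) (a n : nat) :
  0 < rising_weight R a n.+1.
Proof. by rewrite invr_gt0 prodr_gt0 // => j _; rewrite ltr0n. Qed.

(** Both sides invert the product of the 2a+1 integers from n+1 to n+1+2a, splitting off the last or
    the first. This matches successive boundary terms in [weighted_hardy]. *)
Lemma rising_weightSn (R : realType) (a n : nat) :
  rising_weight R a n.+1 / (n.+1 + 2 * a)%:R = rising_weight R a n.+2 / n.+1%:R.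
Proof.
rewrite /rising_weight -!invfM; congr (_^-1).
transitivity (\prod_(j < (2 * a).+1) (n.+1 + j)%:R : R).
  by rewrite big_ord_recr.
rewrite big_ord_recl /= addn0 mulrC; congr (_ * _).
by apply: eq_bigr => j _; rewrite /bump /= addnA addn1.
Qed.

Lemma rising_weightS (R : realType) (a n : nat) :
  rising_weight R a.+1 n
  = rising_weight R a n / ((n + 2 * a)%:R * (n + 2 * a).+1%:R).
Proof.
by rewrite /rising_weight mulnS !big_ord_recr /= -mulrA addnS invfM.
Qed.

(** A completed square: the difference of the two sides is
    ((N + c) y - N x)^2 / (N (N + c)). *)
Lemma hardy_edge (R : realType) (N c x y : R) : 0 < N -> 0 < c ->
  c / (N + c) * x ^+ 2 <= c / N * y ^+ 2 + (x - y) ^+ 2.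
Proof.
move=> N0 c0; have Nc0 : 0 < N + c by lra.
rewrite -subr_ge0.
have -> : c / N * y ^+ 2 + (x - y) ^+ 2 - c / (N + c) * x ^+ 2
    = ((N + c) * y - N * x) ^+ 2 / (N * (N + c)).
  by field; rewrite !gt_eqF.
by rewrite divr_ge0 ?sqr_ge0 // ltW // mulr_gt0.
Qed.

Lemma weighted_hardy (R : realType) (a : nat) (v : nat -> R) (N : nat) :
  v 0%N = 0 ->
  (a%:R + 2^-1) ^+ 2 * \sum_(i < N) rising_weight R a i.+1
      / ((i%:R + (a%:R + 2^-1)) * (i.+1 + 2 * a)%:R) * v i.+1 ^+ 2
  <= \sum_(i < N) rising_weight R a i.+1 * gradient v i.+1 ^+ 2.
Proof.
move=> v0; set c : R := a%:R + 2^-1.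
have c0 : 0 < c by rewrite ltr_wpDl // invr_gt0.
(* The added boundary term closes the induction on [N]; each step is [hardy_edge], an equality on
   the ground state, whose successive ratio is (n+c)/n. *)
suff: c ^+ 2 * \sum_(i < N) rising_weight R a i.+1
      / ((i%:R + c) * (i.+1 + 2 * a)%:R) * v i.+1 ^+ 2
    + c * (rising_weight R a N / (N + 2 * a)%:R) * v N ^+ 2
  <= \sum_(i < N) rising_weight R a i.+1 * gradient v i.+1 ^+ 2.
  apply: le_trans; rewrite lerDl mulr_ge0 ?sqr_ge0 // mulr_ge0 ?(ltW c0) //.
  by rewrite divr_ge0 // invr_ge0 prodr_ge0.
elim: N => [|N IH]; first by rewrite !big_ord0 v0 expr0n !mulr0 addr0.
rewrite !big_ord_recr /= mulrDr.
set S := \sum_(i < N) _ in IH *; set T := \sum_(i < N) _ in IH *.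
set w := rising_weight R a N.+1.
have w0 : 0 < w := rising_weight_gt0 R a N.
have Nc0 : 0 < N%:R + c by rewrite ltr_wpDl.
have Na0 : (0 : R) < (N.+1 + 2 * a)%:R by rewrite ltr0n.
(* This identity merges the new bulk and boundary terms into one. *)
have Na_eq : (N.+1 + 2 * a)%:R = N%:R + c + c :> R.
  by rewrite natrD natrM -natr1 /c; field.
have E : c ^+ 2 * (w / ((N%:R + c) * (N.+1 + 2 * a)%:R) * v N.+1 ^+ 2)
   + c * (w / (N.+1 + 2 * a)%:R) * v N.+1 ^+ 2
   = w * (c / (N%:R + c) * v N.+1 ^+ 2).
  rewrite Na_eq in Na0 *.
  by field; rewrite !gt_eqF.
rewrite -addrA E.
suff H : w * (c / (N%:R + c) * v N.+1 ^+ 2)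
   <= c * (rising_weight R a N / (N + 2 * a)%:R) * v N ^+ 2
      + w * gradient v N.+1 ^+ 2 by lra.
(* At N = 0 the boundary coefficient comes from inverting 0, but it multiplies v 0 = 0. *)
rewrite /gradient /= /w; case: N {IH S T w w0 Nc0 Na0 Na_eq E} => [|N].
  by rewrite v0 subr0 add0r divff ?gt_eqF // mul1r lerDr expr0n /= mulr0.
rewrite rising_weightSn [c * (_ / N.+1%:R)]mulrCA.
rewrite -[_ * (c / N.+1%:R) * _]mulrA -mulrDr.
rewrite ler_pM2l ?rising_weight_gt0 //.
exact: hardy_edge.
Qed.

(** Each step enlarges the factor n+k-1/2 to n+2k+1, so that the Hardy weight stays in the family
    w_k. *)
Lemma iterated_hardy (R : realType) (k : nat) (v : nat -> R) (N : nat) :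
  v 0%N = 0 ->
  (\prod_(a < k) (a%:R + 2^-1)) ^+ 2
    * \sum_(i < N) rising_weight R k i.+1 * v i.+1 ^+ 2
  <= \sum_(i < N) iter k (@gradient R) v i.+1 ^+ 2.
Proof.
elim: k v => [|k IH] v v0.
  rewrite big_ord0 expr1n mul1r; apply: ler_sum => i _ /=.
  by rewrite /rising_weight muln0 big_ord0 invr1 mul1r.
(* The convention [0.-1 = 0] supplies the boundary condition for every gradient. *)
have dv0 : gradient v 0%N = 0 by rewrite /gradient /= subrr.
under [leRHS]eq_bigr do rewrite iterSr.
apply: le_trans (IH _ dv0).
rewrite big_ord_recr /= exprMn -mulrA ler_wpM2l ?sqr_ge0 //.
apply: le_trans (weighted_hardy _ k _ _ v0).
rewrite ler_wpM2l ?sqr_ge0 //; apply: ler_sum => i _.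
rewrite ler_wpM2r ?sqr_ge0 // rising_weightS.
have i0 : (0 : R) <= i%:R by [].
have k0 : (0 : R) <= k%:R by [].
rewrite ler_wpM2l ?(ltW (rising_weight_gt0 _ _ _)) // lef_pV2 ?posrE.
- rewrite mulrC ler_wpM2l // -(natr1 (_ + _)) natrD natrM -(natr1 i); lra.
- by rewrite mulr_gt0 ?ltr0n //; lra.
- by rewrite mulr_gt0 ?ltr0n //; lra.
Qed.

(** Factors pair up around the centre: (n+a-d)(n+a+d) <= (n+a)^2. The induction removes the
    outermost pair. *)
Lemma prod_consecutive_le (a n : nat) :
  (\prod_(j < (2 * a).+1) (n + j) <= (n + a) ^ (2 * a).+1)%N.
Proof.
elim: a n => [|a IH] n; first by rewrite big_ord_recl big_ord0 addn0 muln1.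
rewrite mulnS !addSn add0n big_ord_recl big_ord_recr /= /bump /= addn0.
under eq_bigr do rewrite addnA addn1.
have -> : (n + a.+1)%N = (n.+1 + a)%N by rewrite addnS addSn.
rewrite 2!expnS.
have := IH n.+1.
set P := (\prod_(i < _) _)%N; set Q := (_ ^ _)%N => PQ.
have H : (n * (n + (1 + (2 * a).+1)) <= (n.+1 + a) * (n.+1 + a))%N by nia.
have := leq_mul PQ H; nia.
Qed.

Lemma inv_power_le_weight (R : realType) (a i : nat) :
  ((i.+1 + a)%:R ^+ (2 * a.+1))^-1
  <= rising_weight R a i.+1 / ((i%:R + (a%:R + 2^-1)) * (i.+1 + 2 * a)%:R) :> R.
Proof.
have i0 : (0 : R) <= i%:R by [].
have a0 : (0 : R) <= a%:R by [].
rewrite /rising_weight -invfM lef_pV2 ?posrE.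
- rewrite mulrCA.
  have -> : (\prod_(j < 2 * a) (i.+1 + j)%:R) * (i.+1 + 2 * a)%:R
      = \prod_(j < (2 * a).+1) (i.+1 + j)%:R :> R by rewrite big_ord_recr.
  rewrite mulnS exprS; apply: ler_pM; first lra.
  + by rewrite prodr_ge0.
  + by rewrite natrD -(natr1 i); lra.
  + by rewrite -natr_prod -natrX ler_nat prod_consecutive_le.
- by rewrite exprn_gt0 // ltr0n.
- apply: mulr_gt0; first by apply: prodr_gt0 => j _; rewrite ltr0n.
  by rewrite mulr_gt0 ?ltr0n //; lra.
Qed.

(** The last Hardy step keeps its sharper weight: the factors of w_(l+1) are centred at n+l+1/2, so
    for large n it falls below (n+l)^-(2l+2). *)
Lemma birman_partial_sum (R : realType) (l : nat) (v : nat -> R) (N : nat) :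
  v 0%N = 0 ->
  (\prod_(a < l.+1) (a%:R + 2^-1)) ^+ 2
    * \sum_(i < N) v i.+1 ^+ 2 / (i.+1 + l)%:R ^+ (2 * l.+1)
  <= \sum_(i < N) iter l.+1 (@gradient R) v i.+1 ^+ 2.
Proof.
move=> v0.
have dv0 : gradient v 0%N = 0 by rewrite /gradient /= subrr.
under [leRHS]eq_bigr do rewrite iterSr.
apply: le_trans (iterated_hardy _ _ _ _ dv0).
rewrite big_ord_recr /= exprMn -mulrA ler_wpM2l ?sqr_ge0 //.
apply: le_trans (weighted_hardy _ l _ _ v0).
rewrite ler_wpM2l ?sqr_ge0 //; apply: ler_sum => i _.
by rewrite [leLHS]mulrC ler_wpM2r ?sqr_ge0 // inv_power_le_weight.
Qed.

(** From l to l+1 the left side gains (2l+2)(2l+1) / (4(l+1)) = l+1/2. *)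
Lemma birman_constantE (R : realType) (l : nat) :
  (2 * l)`!%:R / (4 ^+ l * l`!%:R) = \prod_(a < l) (a%:R + 2^-1) :> R.
Proof.
elim: l => [|l IH]; first by rewrite big_ord0 muln0 expr0 fact0 mulr1 divr1.
rewrite big_ord_recr /= -IH mulnS !addSn add0n !factS !natrM exprS.
rewrite -(natr1 l) -(natr1 (2 * l).+1) -(natr1 (2 * l)) natrM.
have f0 : l`!%:R != 0 :> R by rewrite pnatr_eq0 -lt0n fact_gt0.
have p0 : 4 ^+ l != 0 :> R by rewrite expf_neq0.
have l0 : l%:R + 1 != 0 :> R by rewrite natr1 pnatr_eq0.
by field; rewrite f0 p0 l0.
Qed.

(** One Laplacian at n is minus the second gradient at n+1. *)
Lemma iter_laplacianE (R : realType) (m : nat) (u : nat -> R) (n : nat) :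
  (m <= n)%N ->
  iter m (@laplacian R) u n
  = (-1) ^+ m * iter (2 * m) (@gradient R) u (n + m)%N.
Proof.
elim: m n => [|m IH] n mn; first by rewrite muln0 expr0 mul1r addn0.
rewrite mulnS !addSn add0n !iterS {1}/laplacian !IH; [|lia..].
case: n mn => // n mn; rewrite {1 2}/gradient exprS /gradient.
rewrite !addSn !addnS /=; ring.
Qed.

Lemma half_laplacian_sqr (R : realType) (l : nat) (u : nat -> R) (n : nat) :
  (l <= 2 * n)%N ->
  `|half_laplacian l u n| ^+ 2 = iter l (@gradient R) u (n + l./2)%N ^+ 2.
Proof.
move=> ln; rewrite real_normK ?num_real // /half_laplacian.
have := odd_double_half l; rewrite -mul2n; move: l./2 => m.
case: (odd l) => /= lE.
  rewrite {1}/gradient !iter_laplacianE; [|lia..].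
  rewrite -lE add1n iterS /gradient.
  have -> : (n.-1 + m = (n + m).-1)%N by lia.
  by rewrite -mulrBr exprMn sqrr_sign mul1r.
rewrite iter_laplacianE; last lia.
by rewrite exprMn sqrr_sign mul1r -lE.
Qed.

(** Shift and gradient can disagree only at 0, where the vanishing of u makes both values 0; the
    gradient inherits this vanishing. *)
Lemma iter_gradient_shift (R : realType) (p k : nat) (u : nat -> R) (n : nat) :
  (forall j, (j <= p)%N -> u j = 0) ->
  iter k (@gradient R) (fun n => u (n + p)%N) n
  = iter k (@gradient R) u (n + p)%N.
Proof.
elim: k u n => // k IH u n u0; rewrite !iterSr -IH; last first.
  by move=> j jp; rewrite /gradient !u0 ?subrr // (leq_trans (leq_pred _)).
congr (iter k _ _ n); apply/funext => -[|i]; rewrite /gradient //=.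
by rewrite !u0 ?leq_pred.
Qed.

Theorem theorem1p1 (R : realType) (l : nat) (hl : (2 <= l)%N) (u : nat -> R)
    (hu : finitely_supported u) (hu0 : forall k : nat, (k <= l - 1)%N -> u k = 0) :
  (\sum_(0 <= n <oo | (l <= 2 * n)%N) (`|half_laplacian l u n| ^+ 2)%:E
   >= ((((2 * l)`!%:R / (4 ^+ l * l`!%:R)) ^+ 2 : R)%:E
       * \sum_(l <= n <oo) (u n ^+ 2 / n%:R ^+ (2 * l))%:E))%E.
Proof.
case: l hl hu0 => // p _; rewrite subn1 /= => hu0.
have F0 n : 0 <= u n ^+ 2 / n%:R ^+ (2 * p.+1).
  by rewrite divr_ge0 ?sqr_ge0 ?exprn_ge0.
rewrite -nneseriesZl; last by move=> n _; rewrite lee_fin.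
apply: lime_le.
  apply: is_cvg_nneseries => n _ _.
  by rewrite -EFinM lee_fin mulr_ge0 ?sqr_ge0.
apply: nearW => N.
(* [q] is the least n with l <= 2n. Both partial sums keep N-l terms: with n = q+i, the gradient is
   evaluated at q+i+[l./2] = l+i, the index of u on the left. *)
pose q := uphalf p.+1.
have qE : (q + p.+1./2 = p.+1)%N by rewrite /q; lia.
have qN : (q <= q + (N - p.+1))%N by rewrite leq_addr.
apply: le_trans (nneseries_lim_ge (q + (N - p.+1)) _); last first.
  by move=> n _ _; rewrite lee_fin sqr_ge0.
under eq_bigr do rewrite -EFinM.
rewrite !sumEFin lee_fin (big_cat_nat (leq0n q) qN) /=.
apply: ler_wpDl; first by apply: sumr_ge0 => n _; rewrite sqr_ge0.
rewrite -mulr_sumr birman_constantE.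
rewrite -[in leLHS](add0n p.+1) -[in leRHS](add0n q) !big_addn add0n addKn.
rewrite !big_mkord.
pose v n := u (n + p)%N.
have v0 : v 0%N = 0 by apply: hu0.
have := birman_partial_sum _ p v (N - p.+1) v0.
congr (_ * _ <= _).
  by apply: eq_bigr => i _; rewrite /v addnS addSn.
apply: eq_big => i; first by rewrite /q; lia.
move=> _; rewrite half_laplacian_sqr; last by rewrite /q; lia.
by rewrite iter_gradient_shift // -addnA qE addnS addSn.
Qed.
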